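(* Let $\mathcal{M}$ be a strict braided monoidal category. Then the category $\mathcal{M}^p$ of pivotal objects in $\mathcal{M}$ is a strict braided pivotal category, and the forgetful functor $U:\mathcal{M}^p\to\mathcal{M}$, which sends each pivotal object $X^p=(X,X^*,d_X,b_X,d_{X^*},b_{X^*})$ to $X$ and each morphism to itself, is a strict braided monoidal functor.
   Context: An object also denotes its identity morphism; juxtaposition of morphisms is composition; $I$ is the unit object. A duality in a strict monoidal category is a quadruple $(X,X^*,d_X,b_X)$ with $d_X:X^*\otimes X\to I$, $b_X:I\to X\otimes X^*$ such that $(X\otimes d_X)(b_X\otimes X)=\mathrm{id}_X$ and $(d_X\otimes X^* )(X^*\otimes b_X)=\mathrm{id}_{X^*}$; $(X^*,d_X,b_X)$ is then a left dual of $X$. The left dual of $f:X\to Y$ is $f^*=(d_Y\otimes X^* )(Y^*\otimes f\otimes X^* )(Y^*\otimes b_X):Y^*\to X^*$. A pivotal object in $\mathcal{M}$ is a sextuple $X^p=(X,X^*,d_X,b_X,d_{X^*},b_{X^*})$ such that both $(X,X^*,d_X,b_X)$ and $(X^*,X,d_{X^*},b_{X^*})$ are dualities in $\mathcal{M}$. A morphism $f:X^p\to Y^p$ is a morphism $f:X\to Y$ in $\mathcal{M}$ with $f=f^{**}$, where $f^{**}=(d_{X^*}\otimes Y)(X\otimes f^*\otimes Y)(X\otimes b_{Y^*})$. The resulting category $\mathcal{M}^p$ has the following strict pivotal structure: unit $I^p=(I,I,\mathrm{id}_I,\mathrm{id}_I,\mathrm{id}_I,\mathrm{id}_I)$; tensor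 product $X^p\otimes Y^p=(X\otimes Y,Y^*\otimes X^*,d_{X\otimes Y},b_{X\otimes Y},d_{Y^*\otimes X^*},b_{Y^*\otimes X^*})$ with $d_{X\otimes Y}=d_Y(Y^*\otimes d_X\otimes Y)$, $b_{X\otimes Y}=(X\otimes b_Y\otimes X^* )b_X$, $d_{Y^*\otimes X^*}=d_{X^*}(X\otimes d_{Y^*}\otimes X^* )$, $b_{Y^*\otimes X^*}=(Y^*\otimes b_{X^*}\otimes Y)b_{Y^*}$; tensor product of morphisms as in $\mathcal{M}$; left dual $(X^p)^*=(X^*,X,d_{X^*},b_{X^*},d_X,b_X)$ with evaluation $d_X$ and coevaluation $b_X$. A strict pivotal category is a strict monoidal category $\mathcal{N}$ with chosen left duals such that $(-)^*:\mathcal{N}^{\mathrm{op}}\to\mathcal{N}$ is a strict monoidal functor (where $\mathcal{N}^{\mathrm{op}}$ has the reversed tensor product), $d_I=b_I=\mathrm{id}_I$, $d_{X\otimes Y}=d_Y(Y^*\otimes d_X\otimes Y)$, $b_{X\otimes Y}=(X\otimes b_Y\otimes X^* )b_X$, and $(-)^{**}=\mathrm{Id}_{\mathcal{N}}$. A strict monoidal category is braided if it is equipped with natural isomorphisms $\psi_{X,Y}:X\otimes Y\to Y\otimes X$ satisfying $\psi_{X\otimes Y,Z}=(\psi_{X,Z}\otimes Y)(X\otimes\psi_{Y,Z})$ and $\psi_{X,Y\otimes Z}=(Y\otimes\psi_{X,Z})(\psi_{X,Y}\otimes Z)$. A strict braided pivotal category is a strict pivotal category equipped with a braiding. A strict braided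 monoidal functor is a strict monoidal functor $F$ (preserving unit and tensor product on the nose) with $F(\psi_{X,Y})=\psi_{F(X),F(Y)}$. *)

(* Defs.v *)
From mathcomp Require Import ssreflect ssrfun ssrbool.
From Stdlib Require Import ProofIrrelevance.

Set Implicit Arguments.
Unset Strict Implicit.
Unset Printing Implicit Defensive.

Record category : Type := Category {
  ob :> Type;
  hom : ob -> ob -> Type;
  idm : forall X, hom X X;
  comp : forall X Y Z, hom Y Z -> hom X Y -> hom X Z;
  compA : forall W X Y Z (h : hom Y Z) (g : hom X Y) (f : hom W X),
    comp h (comp g f) = comp (comp h g) f;
  comp1m : forall X Y (f : hom X Y), comp (idm Y) f = f;
  compm1 : forall X Y (f : hom X Y), comp f (idm X) = f
}.

Arguments hom {_} X Y.
Arguments idm {_} X.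
Arguments comp {_ X Y Z} g f.

Notation "g \c f" := (comp g f) (at level 40, left associativity).

(* In a strict monoidal category objects such as (X ⊗ Y) ⊗ Z and X ⊗ (Y ⊗ Z)
   are equal, but only propositionally. Two devices express this: [eqhom e] is
   the identity morphism seen as a morphism between objects identified by [e],
   and [heq f g] says that f and g are the same morphism, their domains and
   codomains being equal objects. *)
Definition eqhom {C : category} {X Y : C} (e : X = Y) : hom X Y :=
  match e in _ = Z return hom X Z with erefl => idm X end.

Inductive heq {C : category} {X Y : C} (f : hom X Y) :
  forall X' Y' : C, hom X' Y' -> Prop := heq_refl : heq f f.
Arguments heq {C X Y} f {X' Y'} g.

Notation "f =h g" := (heq f g) (at level 70, no associativity).

Record functor (C D : category) : Type := Functor {
  fob :> C -> D;
  fmor : forall X Y : C, hom X Y -> hom (fob X) (fob Y);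
  fmor1 : forall X : C, fmor (idm X) = idm (fob X);
  fmorM : forall (X Y Z : C) (g : hom Y Z) (f : hom X Y),
    fmor (g \c f) = fmor g \c fmor f
}.
Arguments fmor {C D} F {X Y} f : rename.

Definition op_cat (C : category) : category :=
  @Category C (fun X Y => hom Y X) (fun X => idm X)
    (fun X Y Z g f => f \c g)
    (fun W X Y Z h g f => esym (compA f g h))
    (fun X Y f => compm1 f) (fun X Y f => comp1m f).

Record strict_monoidal (C : category) : Type := StrictMonoidal {
  munit : C;
  tens : C -> C -> C;
  tensm : forall X X' Y Y' : C,
    hom X X' -> hom Y Y' -> hom (tens X Y) (tens X' Y');
  tensm1 : forall X Y : C, tensm (idm X) (idm Y) = idm (tens X Y);
  tensmM : forall (X X' X'' Y Y' Y'' : C) (f' : hom X' X'') (f : hom X X')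
      (g' : hom Y' Y'') (g : hom Y Y'),
    tensm (f' \c f) (g' \c g) = tensm f' g' \c tensm f g;
  tensA : forall X Y Z : C, tens X (tens Y Z) = tens (tens X Y) Z;
  tens1o : forall X : C, tens munit X = X;
  tenso1 : forall X : C, tens X munit = X;
  tensmA : forall (X X' Y Y' Z Z' : C)
      (f : hom X X') (g : hom Y Y') (h : hom Z Z'),
    tensm f (tensm g h) =h tensm (tensm f g) h;
  tens1m : forall (X X' : C) (f : hom X X'), tensm (idm munit) f =h f;
  tensm_1 : forall (X X' : C) (f : hom X X'), tensm f (idm munit) =h f
}.
Arguments munit {C} M : rename.
Arguments tens {C} M X Y : rename.
Arguments tensm {C} M {X X' Y Y'} f g : rename.
Arguments tensA {C} M X Y Z : rename.
Arguments tens1o {C} M X : rename.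
Arguments tenso1 {C} M X : rename.

Section EqHom.
Variable C : category.

Lemma heq_sym (X Y X' Y' : C) (f : hom X Y) (g : hom X' Y') : f =h g -> g =h f.
Proof. by case: X' Y' g /. Qed.

Lemma heq_trans (X Y X' Y' X'' Y'' : C) (f : hom X Y) (g : hom X' Y')
  (h : hom X'' Y'') : f =h g -> g =h h -> f =h h.
Proof. by move=> Hf Hg; case: X'' Y'' h / Hg. Qed.

Lemma heq_op (X Y X' Y' : C) (f : hom X Y) (g : hom X' Y') :
  f =h g -> @heq (op_cat C) Y X f Y' X' g.
Proof. by case: X' Y' g /. Qed.

Lemma eqhom_id (X : C) (e : X = X) : eqhom e = idm X.
Proof. by rewrite (proof_irrelevance _ e erefl). Qed.

Lemma eqhomM (X Y Z : C) (e : X = Y) (e' : Y = Z) :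
  eqhom e' \c eqhom e = eqhom (etrans e e').
Proof. by case: Z / e'; case: Y / e; rewrite /= comp1m. Qed.

Lemma heq_sq (X Y X' Y' : C) (f : hom X Y) (g : hom X' Y')
    (eX : X = X') (eY : Y = Y') :
  f =h g -> eqhom eY \c f = g \c eqhom eX.
Proof.
move=> H; case: X' Y' g / H eX eY => eX eY.
by rewrite !eqhom_id comp1m compm1.
Qed.

Lemma heq_conj (X Y X' Y' : C) (f : hom X Y) (g : hom X' Y')
    (eX : X = X') (eY : Y = Y') :
  f =h g -> g = eqhom eY \c f \c eqhom (esym eX).
Proof.
move=> H; case: X' Y' g / H eX eY => eX eY.
by rewrite !eqhom_id comp1m compm1.
Qed.

Lemma sq_heq (X Y X' Y' : C) (f : hom X Y) (g : hom X' Y')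
    (eX : X = X') (eY : Y = Y') :
  eqhom eY \c f = g \c eqhom eX -> f =h g.
Proof.
case: X' / eX g => g; case: Y' / eY g => g /=.
by rewrite comp1m compm1 => ->.
Qed.

End EqHom.

Definition rev_op (C : category) (M : strict_monoidal C) :
  strict_monoidal (op_cat C).
Proof.
refine (@StrictMonoidal (op_cat C) (munit M) (fun X Y => tens M Y X)
  (fun X X' Y Y' f g => @tensm _ M Y' Y X' X g f) _ _
  (fun X Y Z => esym (tensA M Z Y X)) (tenso1 M) (tens1o M) _ _ _).
- by move=> X Y; exact: tensm1.
- by move=> *; exact: tensmM.
- by move=> X X' Y Y' Z Z' f g h; apply/heq_op/heq_sym/tensmA.
- by move=> X X' f; apply/heq_op/tensm_1.
- by move=> X X' f; apply/heq_op/tens1m.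
Defined.

Record strict_monoidal_functor (C D : category) (M : strict_monoidal C)
    (N : strict_monoidal D) (F : functor C D) : Prop := StrictMonoidalFunctor {
  smf_unit : F (munit M) = munit N;
  smf_tens : forall X Y : C, F (tens M X Y) = tens N (F X) (F Y);
  smf_tensm : forall (X X' Y Y' : C) (f : hom X X') (g : hom Y Y'),
    fmor F (tensm M f g) =h tensm N (fmor F f) (fmor F g)
}.

Section Duality.
Variables (C : category) (M : strict_monoidal C).
Local Notation I := (munit M).
Local Notation "X ⊗ Y" := (tens M X Y) (at level 30, right associativity).
Local Notation "f ⊠ g" := (tensm M f g) (at level 30, right associativity).

Definition is_duality (X Xs : C) (d : hom (Xs ⊗ X) I) (b : hom I (X ⊗ Xs)) :
  Prop :=
  (idm X ⊠ d) \c eqhom (esym (tensA M X Xs X)) \c (b ⊠ idm X) =h idm X /\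
  (d ⊠ idm Xs) \c eqhom (tensA M Xs X Xs) \c (idm Xs ⊠ b) =h idm Xs.

(* f^* = (d_Y ⊗ X^* )(Y^* ⊗ f ⊗ X^* )(Y^* ⊗ b_X) for chosen left duals Xs, Ys of
   X, Y; only the evaluation of Y and the coevaluation of X enter. *)
Definition dual_mor (X Xs Y Ys : C) (dY : hom (Ys ⊗ Y) I)
    (bX : hom I (X ⊗ Xs)) (f : hom X Y) : hom Ys Xs :=
  eqhom (tens1o M Xs) \c (dY ⊠ idm Xs) \c eqhom (tensA M Ys Y Xs) \c
  (idm Ys ⊠ (f ⊠ idm Xs)) \c (idm Ys ⊠ bX) \c eqhom (esym (tenso1 M Ys)).

Lemma ev_tens_eq (Y Ys X Xs : C) :
  (Ys ⊗ Xs) ⊗ (X ⊗ Y) = Ys ⊗ ((Xs ⊗ X) ⊗ Y).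
Proof. by rewrite !tensA. Qed.

Lemma coev_tens_eq (X Xs Y Ys : C) :
  X ⊗ ((Y ⊗ Ys) ⊗ Xs) = (X ⊗ Y) ⊗ (Ys ⊗ Xs).
Proof. by rewrite !tensA. Qed.

(* d_{X ⊗ Y} = d_Y (Y^* ⊗ d_X ⊗ Y) and b_{X ⊗ Y} = (X ⊗ b_Y ⊗ X^* ) b_X *)
Definition ev_tens (X Xs Y Ys : C) (dX : hom (Xs ⊗ X) I)
    (dY : hom (Ys ⊗ Y) I) : hom ((Ys ⊗ Xs) ⊗ (X ⊗ Y)) I :=
  dY \c eqhom (congr1 (tens M Ys) (tens1o M Y)) \c
  (idm Ys ⊠ (dX ⊠ idm Y)) \c eqhom (ev_tens_eq Y Ys X Xs).

Definition coev_tens (X Xs Y Ys : C) (bX : hom I (X ⊗ Xs))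
    (bY : hom I (Y ⊗ Ys)) : hom I ((X ⊗ Y) ⊗ (Ys ⊗ Xs)) :=
  eqhom (coev_tens_eq X Xs Y Ys) \c (idm X ⊠ (bY ⊠ idm Xs)) \c
  eqhom (congr1 (tens M X) (esym (tens1o M Xs))) \c bX.

Definition ev_unit : hom (I ⊗ I) I := eqhom (tens1o M I).
Definition coev_unit : hom I (I ⊗ I) := eqhom (esym (tens1o M I)).

(* The bijection between morphisms W ⊗ X -> I and W -> X^* *)
Let curry (X Xs W : C) (b : hom I (X ⊗ Xs)) (k : hom (W ⊗ X) I) : hom W Xs :=
  eqhom (tens1o M Xs) \c (k ⊠ idm Xs) \c eqhom (tensA M W X Xs) \c
  (idm W ⊠ b) \c eqhom (esym (tenso1 M W)).

Let dual_morE (X Xs Y Ys : C) (dY : hom (Ys ⊗ Y) I)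
    (bX : hom I (X ⊗ Xs)) (f : hom X Y) :
  dual_mor dY bX f = curry bX (dY \c (idm Ys ⊠ f)).
Proof.
rewrite /dual_mor /curry; congr (_ \c _ \c _).
rewrite -!compA; congr (_ \c _).
have -> : (dY \c idm Ys ⊠ f) ⊠ idm Xs
          = (dY ⊠ idm Xs) \c ((idm Ys ⊠ f) ⊠ idm Xs).
  by rewrite -tensmM comp1m.
by rewrite -compA; congr (_ \c _); exact/heq_sq/tensmA.
Qed.

Let curryK (X Xs W : C) (d : hom (Xs ⊗ X) I) (b : hom I (X ⊗ Xs))
    (h : hom W Xs) :
  is_duality d b -> curry b (d \c (h ⊠ idm X)) = h.
Proof.
move=> [_ snake]; rewrite /curry.
have -> : (d \c h ⊠ idm X) ⊠ idm Xs
          = (d ⊠ idm Xs) \c ((h ⊠ idm X) ⊠ idm Xs).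
  by rewrite -tensmM comp1m.
have E1 : ((h ⊠ idm X) ⊠ idm Xs) \c eqhom (tensA M W X Xs)
          = eqhom (tensA M Xs X Xs) \c (h ⊠ idm (X ⊗ Xs)).
  by rewrite -tensm1; exact/esym/heq_sq/tensmA.
have E2 : (h ⊠ idm (X ⊗ Xs)) \c (idm W ⊠ b) = (idm Xs ⊠ b) \c (h ⊠ idm I).
  by rewrite -!tensmM !comp1m !compm1.
have E3 : (h ⊠ idm I) \c eqhom (esym (tenso1 M W))
          = eqhom (esym (tenso1 M Xs)) \c h.
  exact/esym/heq_sq/heq_sym/tensm_1.
have S := heq_sq (tenso1 M Xs) (tens1o M Xs) snake.
rewrite -!compA (compA _ (eqhom (tensA M W X Xs))) E1.
rewrite -!compA (compA (h ⊠ _)) E2.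
rewrite -!compA E3 !compA in S *.
by rewrite S comp1m eqhomM eqhom_id comp1m.
Qed.

Let uncurryK (X Xs W : C) (d : hom (Xs ⊗ X) I) (b : hom I (X ⊗ Xs))
    (k : hom (W ⊗ X) I) :
  is_duality d b -> d \c (curry b k ⊠ idm X) = k.
Proof.
move=> [snake _]; rewrite /curry.
have tX (A B D : C) (g : hom B D) (f : hom A B) :
    (g \c f) ⊠ idm X = (g ⊠ idm X) \c (f ⊠ idm X) by rewrite -tensmM comp1m.
have e1X (A B : C) (e : A = B) :
    eqhom e ⊠ idm X = eqhom (congr1 (fun A => A ⊗ X) e).
  by case: B / e; exact: tensm1.
have eW (A B : C) (e : A = B) : eqhom (congr1 (tens M W) e) = idm W ⊠ eqhom e.
  by case: B / e; rewrite tensm1.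
rewrite !tX !e1X.
rewrite [(k ⊠ _) ⊠ _](heq_conj (tensA M _ _ _) (tensA M _ _ _) (tensmA M _ _ _)).
rewrite [(idm W ⊠ b) ⊠ _](heq_conj (tensA M _ _ _) (tensA M _ _ _) (tensmA M _ _ _)).
rewrite {1}[d](heq_conj (tens1o M _) (tens1o M _) (tens1m M d)) tensm1.
have eM (A B D E : C) (e : A = B) (e' : B = D) (f : hom E A) :
    eqhom e' \c (eqhom e \c f) = eqhom (etrans e e') \c f.
  by rewrite compA eqhomM.
rewrite -!compA !eM eqhom_id comp1m.
have sl : eqhom (tens1o M I) \c ((idm I ⊠ d) \c (k ⊠ idm (Xs ⊗ X)))
          = k \c (eqhom (tenso1 M _) \c (idm (W ⊗ X) ⊠ d)).
  rewrite (compA k) -(heq_sq (tenso1 M _) (tenso1 M I) (tensm_1 M k)).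
  rewrite -!compA -!tensmM !comp1m !compm1.
  by rewrite (proof_irrelevance _ (tenso1 M I) (tens1o M I)).
rewrite (compA (idm I ⊠ d)) compA sl -tensm1.
rewrite [(idm W ⊠ idm X) ⊠ d](heq_conj (tensA M _ _ _) (tensA M _ _ _) (tensmA M _ _ _)).
rewrite -!compA !eM.
have e1 : I ⊗ X = X ⊗ I by rewrite tens1o tenso1.
have sn : (idm X ⊠ d) \c (eqhom (esym (tensA M X Xs X)) \c (b ⊠ idm X)) = eqhom e1.
  rewrite compA.
  rewrite (heq_conj (esym (tens1o M X)) (esym (tenso1 M X)) (heq_sym snake)).
  by rewrite compm1 eqhomM; congr eqhom; exact: proof_irrelevance.
set e := (E in eqhom E \c (_ ⊠ (b ⊠ _) \c _)); rewrite (proof_irrelevance _ e (congr1 (tens M W) (esym (tensA M X Xs X)))).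
rewrite eW (compA (idm W ⊠ eqhom _)) -tensmM (compA (idm W ⊠ (_ ⊠ _))) -tensmM sn !comp1m.
by rewrite -eW !eqhomM eqhom_id compm1.
Qed.

(* The calculations below use that f^* is the unique morphism h with
   d_X (h ⊗ X) = d_Y (Y^* ⊗ f). *)
Lemma dual_mor_uniq (X Xs Y Ys : C) (dX : hom (Xs ⊗ X) I) (bX : hom I (X ⊗ Xs))
    (dY : hom (Ys ⊗ Y) I) (f : hom X Y) (h : hom Ys Xs) :
  is_duality dX bX ->
  dX \c (h ⊠ idm X) = dY \c (idm Ys ⊠ f) -> dual_mor dY bX f = h.
Proof. by move=> DX E; rewrite dual_morE -E (curryK _ DX). Qed.

Lemma dual_morP (X Xs Y Ys : C) (dX : hom (Xs ⊗ X) I) (bX : hom I (X ⊗ Xs))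
    (dY : hom (Ys ⊗ Y) I) (f : hom X Y) :
  is_duality dX bX ->
  dX \c (dual_mor dY bX f ⊠ idm X) = dY \c (idm Ys ⊠ f).
Proof. by move=> DX; rewrite dual_morE uncurryK. Qed.

Lemma dual_mor1 (X Xs : C) (d : hom (Xs ⊗ X) I) (b : hom I (X ⊗ Xs)) :
  is_duality d b -> dual_mor d b (idm X) = idm Xs.
Proof. by move=> D; exact: (dual_mor_uniq D). Qed.

Lemma dual_morM (X Xs Y Ys Z Zs : C)
    (dX : hom (Xs ⊗ X) I) (bX : hom I (X ⊗ Xs))
    (dY : hom (Ys ⊗ Y) I) (bY : hom I (Y ⊗ Ys)) (dZ : hom (Zs ⊗ Z) I)
    (g : hom Y Z) (f : hom X Y) :
  is_duality dX bX -> is_duality dY bY ->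
  dual_mor dZ bX (g \c f) = dual_mor dY bX f \c dual_mor dZ bY g.
Proof.
move=> DX DY; apply: (dual_mor_uniq DX).
set fs := dual_mor dY bX f; set gs := dual_mor dZ bY g.
have -> : (fs \c gs) ⊠ idm X = (fs ⊠ idm X) \c (gs ⊠ idm X).
  by rewrite -tensmM comp1m.
have -> : idm Zs ⊠ (g \c f) = (idm Zs ⊠ g) \c (idm Zs ⊠ f).
  by rewrite -tensmM comp1m.
rewrite !compA (dual_morP _ _ DX) -(dual_morP _ _ DY) -!compA.
by congr (_ \c _); rewrite -!tensmM !comp1m !compm1.
Qed.

End Duality.

Record left_duals (C : category) (M : strict_monoidal C) : Type := LeftDuals {
  dual : C -> C;
  ev : forall X : C, hom (tens M (dual X) X) (munit M);
  coev : forall X : C, hom (munit M) (tens M X (dual X));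
  dualP : forall X : C, is_duality (ev X) (coev X)
}.
Arguments dual {C M} L X : rename.
Arguments ev {C M} L X : rename.
Arguments coev {C M} L X : rename.

Definition dual_functor (C : category) (M : strict_monoidal C)
    (L : left_duals M) : functor (op_cat C) C :=
  @Functor (op_cat C) C (dual L)
    (fun Y X (f : @hom C X Y) => dual_mor (ev L Y) (coev L X) f)
    (fun X => dual_mor1 (dualP L X))
    (fun Z Y X (f : @hom C X Y) (g : @hom C Y Z) =>
       dual_morM (ev L Z) g f (dualP L X) (dualP L Y)).

Record strict_pivotal (C : category) (M : strict_monoidal C) : Type :=
  StrictPivotal {
  sp_duals :> left_duals M;
  sp_functor : strict_monoidal_functor (rev_op M) M (dual_functor sp_duals);
  sp_ev_unit : ev sp_duals (munit M) =h idm (munit M);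
  sp_coev_unit : coev sp_duals (munit M) =h idm (munit M);
  sp_ev_tens : forall X Y : C,
    ev sp_duals (tens M X Y) =h ev_tens (ev sp_duals X) (ev sp_duals Y);
  sp_coev_tens : forall X Y : C,
    coev sp_duals (tens M X Y) =h coev_tens (coev sp_duals X) (coev sp_duals Y);
  sp_bidual : forall X : C, dual sp_duals (dual sp_duals X) = X;
  sp_bidualm : forall (X Y : C) (f : @hom C X Y),
    fmor (dual_functor sp_duals)
      (fmor (dual_functor sp_duals) (f : @hom (op_cat C) Y X)
         : @hom (op_cat C) (dual sp_duals X) (dual sp_duals Y)) =h f
}.

Record braiding (C : category) (M : strict_monoidal C) : Type := Braiding {
  braid :> forall X Y : C, hom (tens M X Y) (tens M Y X);
  braid_iso : forall X Y : C, exists g : hom (tens M Y X) (tens M X Y),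
    g \c braid X Y = idm _ /\ braid X Y \c g = idm _;
  braid_nat : forall (X X' Y Y' : C) (f : hom X X') (g : hom Y Y'),
    braid X' Y' \c tensm M f g = tensm M g f \c braid X Y;
  braid_tensl : forall X Y Z : C,
    braid (tens M X Y) Z =h
    tensm M (braid X Z) (idm Y) \c eqhom (tensA M X Z Y) \c
    tensm M (idm X) (braid Y Z);
  braid_tensr : forall X Y Z : C,
    braid X (tens M Y Z) =h
    tensm M (idm Y) (braid X Z) \c eqhom (esym (tensA M Y X Z)) \c
    tensm M (braid X Y) (idm Z)
}.

Record strict_braided_monoidal_functor (C D : category)
    (M : strict_monoidal C) (psiM : braiding M)
    (N : strict_monoidal D) (psiN : braiding N) (F : functor C D) : Prop :=
  StrictBraidedMonoidalFunctor {
  sbf_monoidal : strict_monoidal_functor M N F;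
  sbf_braid : forall X Y : C, fmor F (psiM X Y) =h psiN (F X) (F Y)
}.

Record strict_braided_pivotal (C : category) : Type := StrictBraidedPivotal {
  sbp_monoidal :> strict_monoidal C;
  sbp_pivotal : strict_pivotal sbp_monoidal;
  sbp_braiding : braiding sbp_monoidal
}.

Section Pivotal.
Variables (C : category) (M : strict_monoidal C).
Local Notation I := (munit M).
Local Notation "X ⊗ Y" := (tens M X Y) (at level 30, right associativity).

(* The sextuples (X, X^*, d_X, b_X, d_{X^*}, b_{X^*}), without conditions *)
Record sextuple : Type := Sextuple {
  po : C;
  pdual : C;
  pd : hom (pdual ⊗ po) I;
  pb : hom I (po ⊗ pdual);
  pds : hom (po ⊗ pdual) I;
  pbs : hom I (pdual ⊗ po)
}.

Record pivotal_object : Type := PivotalObject {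
  psext :> sextuple;
  p_duality : is_duality (pd psext) (pb psext);
  p_dualitys : is_duality (pds psext) (pbs psext)
}.

Definition bidual_mor (X Y : sextuple) (f : hom (po X) (po Y)) :
  hom (po X) (po Y) :=
  dual_mor (pds X) (pbs Y) (dual_mor (pd Y) (pb X) f).
Arguments bidual_mor : clear implicits.

Record pivotal_hom (X Y : pivotal_object) : Type := PivotalHom {
  pmor : hom (po X) (po Y);
  pmorP : pmor = bidual_mor X Y pmor
}.

Lemma pivotal_hom_eq (X Y : pivotal_object) (f g : pivotal_hom X Y) :
  pmor f = pmor g -> f = g.
Proof.
case: f g => [f Pf] [g Pg] /= E; case: g / E Pg => Pg.
by rewrite (proof_irrelevance _ Pf Pg).
Qed.

Fact pivotal_id_subproof (X : pivotal_object) :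
  idm (po X) = bidual_mor X X (idm (po X)).
Proof.
by rewrite /bidual_mor (dual_mor1 (p_duality X)) (dual_mor1 (p_dualitys X)).
Qed.

Fact pivotal_comp_subproof (X Y Z : pivotal_object)
    (g : pivotal_hom Y Z) (f : pivotal_hom X Y) :
  pmor g \c pmor f = bidual_mor X Z (pmor g \c pmor f).
Proof.
rewrite /bidual_mor (dual_morM _ _ _ (p_duality X) (p_duality Y)).
rewrite (dual_morM _ _ _ (p_dualitys Z) (p_dualitys Y)).
by rewrite {1}(pmorP g) {1}(pmorP f).
Qed.

Definition pivotal_category : category.
Proof.
refine (@Category pivotal_object pivotal_hom
  (fun X => PivotalHom (pivotal_id_subproof X))
  (fun X Y Z g f => PivotalHom (pivotal_comp_subproof g f)) _ _ _).
- by move=> *; apply/pivotal_hom_eq/compA.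
- by move=> *; apply/pivotal_hom_eq/comp1m.
- by move=> *; apply/pivotal_hom_eq/compm1.
Defined.

Definition forgetful : functor pivotal_category C :=
  @Functor pivotal_category C (fun X : pivotal_object => po X)
    (fun X Y (f : pivotal_hom X Y) => pmor f)
    (fun X => erefl) (fun X Y Z g f => erefl).

Definition sext_unit : sextuple :=
  @Sextuple I I (ev_unit M) (coev_unit M) (ev_unit M) (coev_unit M).

Definition sext_tens (X Y : sextuple) : sextuple :=
  @Sextuple (po X ⊗ po Y) (pdual Y ⊗ pdual X)
    (ev_tens (pd X) (pd Y)) (coev_tens (pb X) (pb Y))
    (ev_tens (pds Y) (pds X)) (coev_tens (pbs Y) (pbs X)).

Definition sext_dual (X : sextuple) : sextuple :=
  @Sextuple (pdual X) (po X) (pds X) (pbs X) (pd X) (pb X).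

(* The strict pivotal structure that [pivotal_category] is meant to carry. Its
   objects are compared as sextuples and its morphisms as morphisms of C, which
   determines them. *)
Record standard_pivotal_structure (N : strict_monoidal pivotal_category)
    (P : strict_pivotal N) : Prop := StandardPivotalStructure {
  sps_unit : (munit N : pivotal_object) = sext_unit :> sextuple;
  sps_tens : forall X Y : pivotal_object,
    (tens N X Y : pivotal_object) = sext_tens X Y :> sextuple;
  sps_tensm : forall (X X' Y Y' : pivotal_object)
      (f : pivotal_hom X X') (g : pivotal_hom Y Y'),
    pmor (@tensm _ N X X' Y Y' f g) =h tensm M (pmor f) (pmor g);
  sps_dual : forall X : pivotal_object,
    (dual P X : pivotal_object) = sext_dual X :> sextuple;
  sps_ev : forall X : pivotal_object, pmor (ev P X) =h pd X;
  sps_coev : forall X : pivotal_object, pmor (coev P X) =h pb X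
}.

End Pivotal.

(* Main.v *)
(* The braiding lifts to pivotal objects because psi_{X,Y}^* = psi_{X^*,Y^*}: by
   naturality and the hexagons, d_X and d_Y slide through the braiding, and both
   d_{X ⊗ Y} (psi_{X^*,Y^*} ⊗ X ⊗ Y) and d_{Y ⊗ X} (X^* ⊗ Y^* ⊗ psi_{X,Y}) become
   (d_X ⊗ d_Y) (X^* ⊗ psi_{X,Y^*}^{-1} ⊗ Y). Applying this to both dualities of
   X and Y gives psi^{**} = psi. Similarly, (f ⊗ g)^* = g^* ⊗ f^*, and d_X, b_X
   are pivotal morphisms because d_X^* = b_{X^*} and b_{X^*}^* = d_X. *)
From mathcomp Require Import ssreflect ssrfun ssrbool.
From Stdlib Require Import ProofIrrelevance FunctionalExtensionality.
From Stdlib Require Import PropExtensionality.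
Require Import Defs.

Set Implicit Arguments.
Unset Strict Implicit.
Unset Printing Implicit Defensive.

(** * Composition and tensor product of sets of parallel morphisms *)

Section ArrowSets.
Variable C : category.

Lemma heq_eq (X Y : C) (f g : hom X Y) : f =h g -> f = g.
Proof.
by move/(heq_conj erefl erefl) => ->; rewrite !eqhom_id comp1m compm1.
Qed.

Lemma heq_eqhoml (X Y Z : C) (f : hom X Y) (e : Y = Z) : eqhom e \c f =h f.
Proof. by case: Z / e; rewrite /= comp1m. Qed.

Lemma heq_eqhomr (X Y Z : C) (f : hom Y Z) (e : X = Y) : f \c eqhom e =h f.
Proof. by case: Y / e f => f; rewrite /= compm1. Qed.

(* Sets of parallel morphisms. With these, composition is total (the composite is
   empty when the objects do not match) and associative, and the tensor product
   is associative and unital for Leibniz equality, so that the identifications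
   [eqhom] disappear from calculations. *)
Record arrows : Type := Arrows {
  dom : C;
  cod : C;
  has : hom dom cod -> Prop
}.

(** Membership is compared across [=h], so no transport along the equalities of objects appears;
    extensionality of functions and propositions identifies the two predicates. *)
Lemma arrows_eq (a b : arrows) : dom a = dom b -> cod a = cod b ->
  (forall f g, f =h g -> has (a := a) f -> has (a := b) g) ->
  (forall f g, f =h g -> has (a := b) g -> has (a := a) f) -> a = b.
Proof.
case: a b => [X Y A] [X' Y' B] /= eX eY; case: X' / eX B; case: Y' / eY => B AB BA.
congr Arrows; apply: functional_extensionality => f.
by apply: propositional_extensionality; split; [apply: AB | apply: BA].
Qed.

(** Singletons embed the morphisms of [C]: by [arrow_heq] and [heq_arrow], the relation [=h] becomes
    Leibniz equality. *)
Definition arrow (X Y : C) (f : hom X Y) : arrows := @Arrows X Y (eq f).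

Definition ida (X : C) : arrows := arrow (idm X).

Definition compa (a b : arrows) : arrows :=
  @Arrows (dom b) (cod a) (fun h => exists (e : cod b = dom a) g f,
    [/\ has (a := a) g, has (a := b) f & h = g \c eqhom e \c f]).

Lemma arrow_heq (X Y X' Y' : C) (f : hom X Y) (g : hom X' Y') :
  f =h g -> arrow f = arrow g.
Proof. by case: X' Y' g /. Qed.

Lemma heq_arrow (X Y X' Y' : C) (f : hom X Y) (g : hom X' Y') :
  arrow f = arrow g -> f =h g.
Proof.
(* This form mentions the right-hand set only through [arrow g], so [E] can turn it into [arrow f],
   where [f] itself is the witness. *)
move=> E; suff [h -> fh] : exists2 h, has (a := arrow g) h & f =h h by [].
by rewrite -E; exists f.
Qed.

Lemma arrow_inj (X Y : C) (f g : hom X Y) : arrow f = arrow g -> f = g.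
Proof. by move/heq_arrow/heq_eq. Qed.

Lemma arrow_eqhom (X Y : C) (e : X = Y) : arrow (eqhom e) = ida X.
Proof. by case: Y / e. Qed.

Lemma arrowM (X Y Z : C) (g : hom Y Z) (f : hom X Y) :
  arrow (g \c f) = compa (arrow g) (arrow f).
Proof.
apply: arrows_eq => //= h k /heq_eq <-{k}.
  by move=> <-; exists erefl, g, f; split=> //=; rewrite compm1.
by case=> e [_] [_] [<- <- ->]; rewrite eqhom_id compm1.
Qed.

Lemma compaA (a b c : arrows) : compa a (compa b c) = compa (compa a b) c.
Proof.
apply: arrows_eq => //= h k /heq_eq <-{k}.
  case=> e [g] [_] [ag [e' [f] [l] [bf cl ->]] ->].
  exists e', (g \c eqhom e \c f), l; split=> //; last by rewrite -!compA.
  by exists e, g, f.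
case=> e [_] [l] [[e' [g] [f] [ag bf ->]] cl ->].
exists e', g, (f \c eqhom e \c l); split=> //; last by rewrite -!compA.
by exists e, f, l.
Qed.

(** The equation on objects is a hypothesis, so that the lemma applies to objects that agree only
    propositionally, such as reassociated tensor products. *)
Lemma comp1a (X : C) (a : arrows) : cod a = X -> compa (ida X) a = a.
Proof.
move<-; apply: arrows_eq => //= h k /heq_eq <-{k}.
  by case=> e [_] [f] [<- af ->]; rewrite eqhom_id !comp1m.
by move=> ah; exists erefl, (idm _), h; split; rewrite //= !comp1m.
Qed.

Lemma compa1 (X : C) (a : arrows) : dom a = X -> compa a (ida X) = a.
Proof.
move<-; apply: arrows_eq => //= h k /heq_eq <-{k}.
  by case=> e [f] [_] [af <- ->]; rewrite eqhom_id !compm1.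
by move=> ah; exists erefl, h, (idm _); split; rewrite //= !compm1.
Qed.

Variable M : strict_monoidal C.

Definition tensa (a b : arrows) : arrows :=
  @Arrows (tens M (dom a) (dom b)) (tens M (cod a) (cod b))
    (fun h => exists f g, [/\ has (a := a) f, has (a := b) g & h = tensm M f g]).

Lemma arrow_tensm (X X' Y Y' : C) (f : hom X X') (g : hom Y Y') :
  arrow (tensm M f g) = tensa (arrow f) (arrow g).
Proof.
apply: arrows_eq => //= h k /heq_eq <-{k}; first by move=> <-; exists f, g.
by case=> _ [_] [<- <- ->].
Qed.

Lemma ida_tens (X Y : C) : ida (tens M X Y) = tensa (ida X) (ida Y).
Proof. by rewrite -arrow_tensm tensm1. Qed.

Lemma tensaA (a b c : arrows) : tensa a (tensa b c) = tensa (tensa a b) c.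
Proof.
apply: arrows_eq => /= [||h k hk|h k hk]; try exact: tensA.
  case=> f [_] [af [g] [l] [bg cl ->]] E.
  exists (tensm M f g), l; split=> //; first by exists f, g.
  apply: heq_eq; apply: heq_trans (heq_sym hk) _; rewrite E; exact: tensmA.
case=> [_] [l] [[f] [g] [af bg ->] cl] E.
exists f, (tensm M g l); split=> //; first by exists g, l.
by apply: heq_eq; apply: heq_trans hk _; rewrite E; apply/heq_sym/tensmA.
Qed.

Lemma tens1a (a : arrows) : tensa (ida (munit M)) a = a.
Proof.
apply: arrows_eq => /= [||h k hk|h k hk]; try exact: tens1o.
  case=> _ [f] [<- af E]; suff -> : k = f by [].
  by apply: heq_eq; apply: heq_trans (heq_sym hk) _; rewrite E; apply: tens1m.
move=> ak; exists (idm _), k; split=> //; apply: heq_eq; apply: heq_trans hk _.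
exact/heq_sym/tens1m.
Qed.

Lemma tensa1 (a : arrows) : tensa a (ida (munit M)) = a.
Proof.
apply: arrows_eq => /= [||h k hk|h k hk]; try exact: tenso1.
  case=> f [_] [af <- E]; suff -> : k = f by [].
  by apply: heq_eq; apply: heq_trans (heq_sym hk) _; rewrite E; apply: tensm_1.
move=> ak; exists k, (idm _); split=> //; apply: heq_eq; apply: heq_trans hk _.
exact/heq_sym/tensm_1.
Qed.

(** The side conditions matter: the left side is empty unless the factors match, while the right
    side only asks that their tensor products match. *)
Lemma tensaM (a b c d : arrows) : cod b = dom a -> cod d = dom c ->
  tensa (compa a b) (compa c d) = compa (tensa a c) (tensa b d).
Proof.
case: a b c d => [X Y A] [W X' B] [X2 Y2 A2] [W2 X2' B2] /= eX eX2.
case: X / eX A => A; case: X2 / eX2 A2 => A2.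
apply: arrows_eq => //= h k /heq_eq <-{k}.
  case=> [_] [_] [[e [f] [g] [Af Bg ->]] [e2 [f2] [g2] [Af2 Bg2 ->]] ->].
  exists erefl, (tensm M f f2), (tensm M g g2).
  split; [by exists f, f2 | by exists g, g2|].
  by rewrite !eqhom_id !compm1 tensmM.
case=> e [_] [_] [[f] [f2] [Af Af2 ->] [g] [g2] [Bg Bg2 ->] ->].
exists (f \c g), (f2 \c g2); split; last by rewrite eqhom_id compm1 tensmM.
  by exists erefl, f, g; rewrite compm1.
by exists erefl, f2, g2; rewrite compm1.
Qed.

End ArrowSets.
Arguments tensaA {C M} a b c.
Arguments tens1a {C M} a.
Arguments tensa1 {C M} a.

Ltac solve_ob_eq := by rewrite /= ?tensA ?tens1o ?tenso1 ?tensA.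
(** Nests tensor products to the right and removes units, once more after reassociation because this
    can expose new ones. *)
Ltac normalize_tens := rewrite /= ?ida_tens ?tens1a ?tensa1 -?tensaA ?tens1a ?tensa1.

(** * Dualities and dual morphisms *)

Section DualityCalculus.
Variables (C : category) (M : strict_monoidal C).
Local Notation I := (munit M).
(** Objects stand for identities and morphisms for singletons, so that formulas read as in a strict
    category. *)
Local Coercion ida : ob >-> arrows.
Local Coercion arrow : hom >-> arrows.
Local Notation "a ⊗ b" := (tensa M a b) (at level 30, right associativity).
Local Notation "a ∘ b" := (compa a b) (at level 40, left associativity).

Lemma arrow_eqhoml (X Y Z : C) (f : hom X Y) (e : Y = Z) :
  eqhom e \c f = f :> arrows C.
Proof. exact/arrow_heq/heq_eqhoml. Qed.

Lemma arrow_eqhomr (X Y Z : C) (f : hom Y Z) (e : X = Y) :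
  f \c eqhom e = f :> arrows C.
Proof. exact/arrow_heq/heq_eqhomr. Qed.

Lemma arrow1 (X : C) : arrow (idm X) = X. Proof. by []. Qed.

Definition arrow_catE :=
  (arrow_eqhoml, arrow_eqhomr, arrowM, @arrow_tensm C M, arrow1).

Lemma whiskerl (X : C) (a b : arrows C) : cod b = dom a ->
  X ⊗ (a ∘ b) = (X ⊗ a) ∘ (X ⊗ b).
Proof. by move=> e; rewrite -tensaM // comp1a. Qed.

Lemma whiskerr (X : C) (a b : arrows C) : cod b = dom a ->
  (a ∘ b) ⊗ X = (a ⊗ X) ∘ (b ⊗ X).
Proof. by move=> e; rewrite -tensaM // comp1a. Qed.

(** Both composites are [a ⊗ b], hence morphisms on disjoint factors slide past each other. *)
Lemma tensa_exchange (a b : arrows C) : (a ⊗ cod b) ∘ (dom a ⊗ b) = (cod a ⊗ b) ∘ (a ⊗ dom b).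
Proof. by rewrite -!tensaM // !comp1a // !compa1. Qed.

(** Once [k] has been carried out first, only the unit is left between [a] and [c], and it
    disappears. *)
Lemma tens_cod1 (a k c : arrows C) : cod k = I ->
  a ⊗ k ⊗ c = (a ⊗ c) ∘ (dom a ⊗ k ⊗ dom c).
Proof.
move=> e; rewrite -{2}(@tens1a C M c) -!tensaM //; last by rewrite /= e.
by rewrite comp1a // !compa1.
Qed.

Lemma dualityE (X Xs : C) (d : hom (tens M Xs X) I) (b : hom I (tens M X Xs)) :
  is_duality d b <->
  (X ⊗ d) ∘ (b ⊗ X) = X :> arrows C /\ (d ⊗ Xs) ∘ (Xs ⊗ b) = Xs :> arrows C.
Proof.
rewrite /is_duality; split=> -[].
  by move=> /arrow_heq + /arrow_heq; rewrite !arrow_catE.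
by move=> E1 E2; split; apply: heq_arrow; rewrite !arrow_catE.
Qed.

Lemma arrow_dual_mor (X Xs Y Ys : C) (dY : hom (tens M Ys Y) I)
    (bX : hom I (tens M X Xs)) (f : hom X Y) :
  dual_mor dY bX f = (dY ⊗ Xs) ∘ (Ys ⊗ f ⊗ Xs) ∘ (Ys ⊗ bX) :> arrows C.
Proof. by rewrite /dual_mor !arrow_catE. Qed.

Lemma arrow_ev_tens (X Xs Y Ys : C) (dX : hom (tens M Xs X) I)
    (dY : hom (tens M Ys Y) I) :
  ev_tens dX dY = dY ∘ (Ys ⊗ dX ⊗ Y) :> arrows C.
Proof. by rewrite /ev_tens !arrow_catE. Qed.

Lemma arrow_coev_tens (X Xs Y Ys : C) (bX : hom I (tens M X Xs))
    (bY : hom I (tens M Y Ys)) :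
  coev_tens bX bY = (X ⊗ bY ⊗ Xs) ∘ bX :> arrows C.
Proof. by rewrite /coev_tens !arrow_catE. Qed.

Lemma arrow_ev_unit : ev_unit M = I :> arrows C.
Proof. by rewrite /ev_unit arrow_eqhom tens1o. Qed.

Lemma arrow_coev_unit : coev_unit M = I :> arrows C.
Proof. by rewrite /coev_unit arrow_eqhom. Qed.

(* The order matters: [arrow_catE] would unfold [ev_tens] and its companions. *)
Definition arrowE := (arrow_ev_tens, arrow_coev_tens, arrow_ev_unit,
  arrow_coev_unit, arrow_catE, @ida_tens C M).

Lemma duality_unit : is_duality (ev_unit M) (coev_unit M).
Proof.
by apply/dualityE; rewrite arrow_ev_unit arrow_coev_unit !tens1a comp1a.
Qed.

(** In each snake of X ⊗ Y the morphisms b_Y and d_X act on disjoint factors. Exchanging them brings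
    the snake of X together; contracting it leaves the snake of Y. *)
Lemma duality_tens (X Xs Y Ys : C)
    (dX : hom (tens M Xs X) I) (bX : hom I (tens M X Xs))
    (dY : hom (tens M Ys Y) I) (bY : hom I (tens M Y Ys)) :
  is_duality dX bX -> is_duality dY bY ->
  is_duality (ev_tens dX dY) (coev_tens bX bY).
Proof.
move=> /dualityE[X1 X2] /dualityE[Y1 Y2]; apply/dualityE.
rewrite arrow_ev_tens arrow_coev_tens.
rewrite !whiskerl ?whiskerr; try solve_ob_eq.
rewrite !ida_tens -!tensaA; split.
- have := tensa_exchange (X ⊗ bY) (dX ⊗ Y); normalize_tens => E.
  rewrite !compaA -(compaA _ _ (X ⊗ bY ⊗ _)) -E !compaA.
  rewrite -whiskerl; last solve_ob_eq.
  rewrite -(compaA (X ⊗ _)) (tensaA X dX) (tensaA bX) -whiskerr; last solve_ob_eq.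
  by rewrite X1 -whiskerl ?Y1 ?comp1a.
- have := tensa_exchange (Ys ⊗ dX) (bY ⊗ Xs); normalize_tens => E.
  rewrite !compaA -(compaA _ _ (Ys ⊗ Xs ⊗ X ⊗ bY ⊗ _)) E !compaA.
  rewrite -(compaA (_ ∘ _)) -(@whiskerl Ys (dX ⊗ Xs)) ?X2; last solve_ob_eq.
  rewrite (tensaA dY) (tensaA Ys bY) -whiskerr ?Y2; last solve_ob_eq.
  by rewrite -ida_tens comp1a.
Qed.

(** By uniqueness of duals it suffices to move both factors through the evaluation: the inner d_X
    turns f^* into f, then the outer d_Y turns g^* into g. *)
Lemma dual_mor_tens (X Xs X' Xs' Y Ys Y' Ys' : C)
    (dX : hom (tens M Xs X) I) (bX : hom I (tens M X Xs))
    (dY : hom (tens M Ys Y) I) (bY : hom I (tens M Y Ys))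
    (dX' : hom (tens M Xs' X') I) (dY' : hom (tens M Ys' Y') I)
    (f : hom X X') (g : hom Y Y') :
  is_duality dX bX -> is_duality dY bY ->
  dual_mor (ev_tens dX' dY') (coev_tens bX bY) (tensm M f g)
  = tensm M (dual_mor dY' bY g) (dual_mor dX' bX f).
Proof.
move=> DX DY; apply: (dual_mor_uniq (duality_tens DX DY)); apply: arrow_inj.
have := congr1 (@arrow C _ _) (dual_morP dX' f DX).
have := congr1 (@arrow C _ _) (dual_morP dY' g DY).
move: (dual_mor dY' bY g) (dual_mor dX' bX f) => gs fs.
rewrite !arrowE => Eg Ef.
rewrite -!compaA -!tensaA.
rewrite (tensaA fs) (tensaA Xs') -!tensaM ?Ef; try solve_ob_eq.
rewrite comp1a // !compa1 // comp1a //.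
(* This common middle factor ends in the unit, so it can be split off on the right of both sides;
   [Eg] relates what remains. *)
set k := _ ∘ (Xs' ⊗ f).
rewrite (@tens_cod1 gs) // (@tens_cod1 Ys') //=.
by rewrite !compaA Eg.
Qed.

(** By uniqueness, the claim is that d is unchanged when a snake of (ds, bs) is inserted on its
    factor X^* . *)
Lemma dual_mor_ev (X Xs : C) (d : hom (tens M Xs X) I) (b : hom I (tens M X Xs))
    (ds : hom (tens M X Xs) I) (bs : hom I (tens M Xs X)) :
  is_duality d b -> is_duality ds bs ->
  dual_mor (ev_unit M) (coev_tens bs b) d = bs.
Proof.
move=> D Ds; apply: (dual_mor_uniq (duality_tens Ds D)); apply: arrow_inj.
move/dualityE: Ds => [S _].
rewrite !arrowE tens1a comp1a //.
rewrite tensaA -compaA (tensaA bs) -whiskerr ?S; last solve_ob_eq.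
by rewrite -ida_tens compa1.
Qed.

(** As for [dual_mor_ev], with the other snake inserted on the factor X of d. *)
Lemma dual_mor_coev (X Xs : C) (d : hom (tens M Xs X) I)
    (ds : hom (tens M X Xs) I) (bs : hom I (tens M Xs X)) :
  is_duality ds bs ->
  dual_mor (ev_tens ds d) (coev_unit M) bs = d.
Proof.
move=> Ds; apply: (dual_mor_uniq duality_unit); apply: arrow_inj.
move/dualityE: Ds => [_ S].
rewrite !arrowE tensa1 comp1a //.
rewrite -tensaA -compaA -whiskerl ?S; last solve_ob_eq.
by rewrite -ida_tens compa1.
Qed.

(** * The braiding with the unit, and its dual *)

Section Braiding.
Variable psi : braiding M.

Lemma braid_arrow_nat (X X' Y Y' : C) (f : hom X X') (g : hom Y Y') :
  psi X' Y' ∘ (f ⊗ g) = (g ⊗ f) ∘ psi X Y :> arrows C.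
Proof. by rewrite -!arrow_tensm -!arrowM braid_nat. Qed.

Lemma braid_arrow_tensl (X Y Z : C) :
  psi (tens M X Y) Z = (psi X Z ⊗ Y) ∘ (X ⊗ psi Y Z) :> arrows C.
Proof. by rewrite (arrow_heq (braid_tensl psi X Y Z)) !arrowE. Qed.

Lemma braid_arrow_tensr (X Y Z : C) :
  psi X (tens M Y Z) = (Y ⊗ psi X Z) ∘ (psi X Y ⊗ Z) :> arrows C.
Proof. by rewrite (arrow_heq (braid_tensr psi X Y Z)) !arrowE. Qed.

(* psi_{X, I} is idempotent because I = I ⊗ I, and it is invertible. *)
Lemma braidx1 (X : C) : psi X I = X :> arrows C.
Proof.
have E := braid_arrow_tensr X I I.
rewrite tens1a tensa1 tens1o in E.
have [g [/(congr1 (@arrow C _ _)) gK _]] := braid_iso psi X I.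
rewrite arrowM arrow1 ida_tens tensa1 in gK.
by rewrite -[RHS]gK {2}E compaA gK comp1a //= tens1o.
Qed.

Lemma braid1x (X : C) : psi I X = X :> arrows C.
Proof.
have E := braid_arrow_tensl I I X.
rewrite tens1a tensa1 tens1o in E.
have [g [/(congr1 (@arrow C _ _)) gK _]] := braid_iso psi I X.
rewrite arrowM arrow1 ida_tens tens1a in gK.
by rewrite -[RHS]gK {2}E compaA gK comp1a //= tenso1.
Qed.

Lemma dual_mor_braid (X Xs Y Ys : C)
    (dX : hom (tens M Xs X) I) (bX : hom I (tens M X Xs))
    (dY : hom (tens M Ys Y) I) (bY : hom I (tens M Y Ys)) :
  is_duality dX bX -> is_duality dY bY ->
  dual_mor (ev_tens dY dX) (coev_tens bX bY) (psi X Y) = psi Xs Ys.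
Proof.
move=> DX DY; apply: (dual_mor_uniq (duality_tens DX DY)); apply: arrow_inj.
rewrite !arrowE -!tensaA.
have [i [_ /(congr1 (@arrow C _ _)) iK]] := braid_iso psi X Ys.
rewrite arrowM arrow1 ida_tens in iK.
(* The hexagon merges the two braidings into psi_{X, Y^* ⊗ Y}; naturality with respect to d_Y leaves
   psi_{X,I}, an identity. Symmetrically for [pY]. *)
have pX : (dY ⊗ X) ∘ (Ys ⊗ psi X Y) ∘ (psi X Ys ⊗ Y) = X ⊗ dY.
  rewrite -compaA -braid_arrow_tensr -[in LHS](braid_arrow_nat (idm X) dY).
  by rewrite braidx1 comp1a // /= tenso1.
have pY : (Ys ⊗ dX) ∘ (psi Xs Ys ⊗ X) ∘ (Xs ⊗ psi X Ys) = dX ⊗ Ys.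
  rewrite -compaA -braid_arrow_tensl -[in LHS](braid_arrow_nat dX (idm Ys)).
  by rewrite braid1x comp1a // /= tens1o.
(* Precomposition with [k] turns both sides into d_X ⊗ d_Y; afterwards [k] is cancelled by its right
   inverse, built from [i]. *)
set k := Xs ⊗ psi X Ys ⊗ Y.
have E : dY ∘ (Ys ⊗ dX ⊗ Y) ∘ (psi Xs Ys ⊗ X ⊗ Y) ∘ k
    = dX ∘ (Xs ⊗ dY ⊗ X) ∘ (Xs ⊗ Ys ⊗ psi X Y) ∘ k.
  rewrite -2!(compaA dY) -2!(compaA dX) /k -!whiskerl; try solve_ob_eq.
  rewrite pX (tensaA Ys) (tensaA (psi _ _)) (tensaA Xs) -!whiskerr ?pY; try solve_ob_eq.
  by have := tensa_exchange dX dY; normalize_tens => ->.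
have kK : k ∘ (Xs ⊗ i ⊗ Y) = Xs ⊗ Ys ⊗ X ⊗ Y.
  by rewrite /k -!tensaM // iK !comp1a // -!tensaA.
move/(congr1 (fun a => a ∘ (Xs ⊗ i ⊗ Y))): E.
by rewrite -!(compaA _ k) kK -!ida_tens !compa1 //; solve_ob_eq.
Qed.
End Braiding.

End DualityCalculus.

(** * Pivotal objects and morphisms compared through arrows of [C] *)

Section PivotalObjects.
Variables (C : category) (M : strict_monoidal C).
Local Notation I := (munit M).
Local Coercion ida : ob >-> arrows.
Local Coercion arrow : hom >-> arrows.
Local Notation "a ⊗ b" := (tensa M a b) (at level 30, right associativity).
Local Notation "a ∘ b" := (compa a b) (at level 40, left associativity).
Local Notation Mp := (pivotal_category M).

Lemma sextuple_eq (S T : sextuple M) : po S = po T -> pdual S = pdual T ->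
  pd S = pd T :> arrows C -> pb S = pb T :> arrows C ->
  pds S = pds T :> arrows C -> pbs S = pbs T :> arrows C -> S = T.
Proof.
case: S T => [X Xs d b ds bs] [Y Ys d' b' ds' bs'] /= eX eXs.
case: Y / eX d' b' ds' bs'; case: Ys / eXs => d' b' ds' bs'.
by do 4 move/arrow_inj->.
Qed.

Lemma pivotal_object_eq (X Y : pivotal_object M) : X = Y :> sextuple M -> X = Y.
Proof.
case: X Y => [X D Ds] [Y D' Ds'] /= e; case: Y / e D' Ds' => D' Ds'.
by rewrite (proof_irrelevance _ D D') (proof_irrelevance _ Ds Ds').
Qed.

(** Forgetting is faithful but does not see the chosen duals, so the equalities of pivotal objects
    are required separately. *)
Lemma pivotal_heq (X Y X' Y' : Mp) (f : hom X Y) (g : hom X' Y') :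
  X = X' -> Y = Y' -> pmor f = pmor g :> arrows C -> f =h g.
Proof.
move=> eX eY; case: X' / eX g; case: Y' / eY => g /arrow_inj/pivotal_hom_eq->.
exact: heq_refl.
Qed.

Lemma heq_pmor (X Y X' Y' : Mp) (f : hom X Y) (g : hom X' Y') :
  f =h g -> pmor f = pmor g :> arrows C.
Proof. by case: X' Y' g /. Qed.

Lemma pmor_eqhoml (X Y Z : Mp) (f : hom X Y) (e : Y = Z) :
  pmor (eqhom e \c f) = pmor f :> arrows C.
Proof. exact/heq_pmor/heq_eqhoml. Qed.

Lemma pmor_eqhomr (X Y Z : Mp) (f : hom Y Z) (e : X = Y) :
  pmor (f \c eqhom e) = pmor f :> arrows C.
Proof. exact/heq_pmor/heq_eqhomr. Qed.

Lemma pmorM (X Y Z : Mp) (g : hom Y Z) (f : hom X Y) :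
  pmor (g \c f) = pmor g ∘ pmor f :> arrows C.
Proof. exact: arrowM. Qed.

(** * The strict monoidal structure on pivotal objects *)

Definition pivotal_unit : pivotal_object M :=
  @PivotalObject C M (sext_unit M) (duality_unit M) (duality_unit M).

Definition pivotal_tens (X Y : pivotal_object M) : pivotal_object M :=
  @PivotalObject C M (sext_tens X Y)
    (duality_tens (p_duality X) (p_duality Y))
    (duality_tens (p_dualitys Y) (p_dualitys X)).

Definition pivotal_dual (X : pivotal_object M) : pivotal_object M :=
  @PivotalObject C M (sext_dual X) (p_dualitys X) (p_duality X).

Lemma pivotal_tensA (X Y Z : pivotal_object M) :
  pivotal_tens X (pivotal_tens Y Z) = pivotal_tens (pivotal_tens X Y) Z.
Proof.
apply/pivotal_object_eq/sextuple_eq => /=; rewrite ?tensA // !arrowE whiskerr ?whiskerl;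
  try solve_ob_eq; by rewrite !compaA -?tensaA.
Qed.

Lemma pivotal_tens1o (X : pivotal_object M) : pivotal_tens pivotal_unit X = X.
Proof.
apply/pivotal_object_eq/sextuple_eq => /=; rewrite ?tens1o ?tenso1 // !arrowE;
  by rewrite ?tens1a ?tensa1 -?ida_tens ?comp1a ?compa1.
Qed.

Lemma pivotal_tenso1 (X : pivotal_object M) : pivotal_tens X pivotal_unit = X.
Proof.
apply/pivotal_object_eq/sextuple_eq => /=; rewrite ?tens1o ?tenso1 // !arrowE;
  by rewrite ?tens1a ?tensa1 -?ida_tens ?comp1a ?compa1.
Qed.

Lemma pivotal_tensm_subproof (X X' Y Y' : pivotal_object M)
    (f : pivotal_hom X X') (g : pivotal_hom Y Y') :
  tensm M (pmor f) (pmor g) =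
  @bidual_mor C M (pivotal_tens X Y) (pivotal_tens X' Y') (tensm M (pmor f) (pmor g)).
Proof.
rewrite /bidual_mor /= (dual_mor_tens _ _ _ _ (p_duality X) (p_duality Y)).
rewrite (dual_mor_tens _ _ _ _ (p_dualitys Y') (p_dualitys X')).
by rewrite {1}(pmorP f) {1}(pmorP g).
Qed.

Definition pivotal_tensm (X X' Y Y' : Mp) (f : hom X X') (g : hom Y Y') :
  @hom Mp (pivotal_tens X Y) (pivotal_tens X' Y') :=
  @PivotalHom C M (pivotal_tens X Y) (pivotal_tens X' Y') _
    (pivotal_tensm_subproof f g).

(** The laws for morphisms hold since they hold in [C]. The term stays transparent, so that the
    tensor product computes in later proofs. *)
Definition pivotal_monoidal : strict_monoidal Mp.
Proof.
refine (@StrictMonoidal Mp pivotal_unit pivotal_tens pivotal_tensm _ _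
  pivotal_tensA pivotal_tens1o pivotal_tenso1 _ _ _).
- by move=> X Y; apply/pivotal_hom_eq/tensm1.
- by move=> *; apply/pivotal_hom_eq/tensmM.
- move=> *; apply: pivotal_heq; try exact: pivotal_tensA.
  by rewrite /= !arrowE tensaA.
- move=> *; apply: pivotal_heq; try exact: pivotal_tens1o.
  by rewrite /= !arrowE tens1a.
- move=> *; apply: pivotal_heq; try exact: pivotal_tenso1.
  by rewrite /= !arrowE tensa1.
Defined.
Local Notation N := pivotal_monoidal.

Lemma pmor_tensm (X X' Y Y' : Mp) (f : hom X X') (g : hom Y Y') :
  @pmor C M (pivotal_tens X Y) (pivotal_tens X' Y') (tensm N f g) =
  tensm M (pmor f) (pmor g).
Proof. by []. Qed.

(** * Duals of pivotal objects and the strict pivotal structure *)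

Lemma pivotal_dual_mor (X Xs Y Ys : Mp) (dY : hom (tens N Ys Y) (munit N))
    (bX : hom (munit N) (tens N X Xs)) (f : hom X Y) :
  @pmor C M Ys Xs (dual_mor dY bX f) =
  @dual_mor C M (po X) (po Xs) (po Y) (po Ys) (pmor dY) (pmor bX) (pmor f).
Proof.
apply: arrow_inj; rewrite arrow_dual_mor /dual_mor.
by rewrite !(pmor_eqhoml, pmor_eqhomr, pmorM) /= !arrowE.
Qed.

Lemma pivotal_is_duality (X Xs : Mp) (d : hom (tens N Xs X) (munit N))
    (b : hom (munit N) (tens N X Xs)) :
  @is_duality C M (po X) (po Xs) (pmor d) (pmor b) -> is_duality d b.
Proof.
move/dualityE => [E1 E2]; split; apply: pivotal_heq; try exact: pivotal_tenso1;
  try exact: pivotal_tens1o;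
by rewrite !(pmor_eqhoml, pmor_eqhomr, pmorM) /= !arrowE.
Qed.

Lemma pivotal_ev_subproof (X : pivotal_object M) :
  pd X = @bidual_mor C M (pivotal_tens (pivotal_dual X) X) pivotal_unit (pd X).
Proof.
rewrite /bidual_mor /= (dual_mor_ev (p_duality X) (p_dualitys X)).
by rewrite (dual_mor_coev _ (p_dualitys X)).
Qed.

(** With the roles of X and X^* exchanged, b_X^* = d_{X^*} and d_{X^*}^* = b_X. *)
Lemma pivotal_coev_subproof (X : pivotal_object M) :
  pb X = @bidual_mor C M pivotal_unit (pivotal_tens X (pivotal_dual X)) (pb X).
Proof.
rewrite /bidual_mor /= (dual_mor_coev _ (p_duality X)).
by rewrite (dual_mor_ev (p_dualitys X) (p_duality X)).
Qed.

Definition pivotal_ev (X : pivotal_object M) :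
    pivotal_hom (pivotal_tens (pivotal_dual X) X) pivotal_unit :=
  @PivotalHom C M (pivotal_tens (pivotal_dual X) X) pivotal_unit _
    (pivotal_ev_subproof X).

Definition pivotal_coev (X : pivotal_object M) :
    pivotal_hom pivotal_unit (pivotal_tens X (pivotal_dual X)) :=
  @PivotalHom C M pivotal_unit (pivotal_tens X (pivotal_dual X)) _
    (pivotal_coev_subproof X).

Definition pivotal_duals : left_duals N :=
  @LeftDuals Mp N pivotal_dual pivotal_ev pivotal_coev
    (fun X => @pivotal_is_duality X (pivotal_dual X)
       (pivotal_ev X) (pivotal_coev X) (p_duality X)).

Lemma pmor_dual (X Y : Mp) (f : hom X Y) :
  @pmor C M (pivotal_dual Y) (pivotal_dual X)
    (@fmor _ _ (dual_functor pivotal_duals) Y X f) =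
  dual_mor (pd Y) (pb X) (pmor f).
Proof. exact: pivotal_dual_mor. Qed.

Lemma pivotal_dual_unit : pivotal_dual pivotal_unit = pivotal_unit.
Proof. exact: pivotal_object_eq. Qed.

Lemma pivotal_dual_tens (X Y : pivotal_object M) :
  pivotal_dual (pivotal_tens X Y) = pivotal_tens (pivotal_dual Y) (pivotal_dual X).
Proof. exact: pivotal_object_eq. Qed.

Lemma pivotal_dualK (X : pivotal_object M) : pivotal_dual (pivotal_dual X) = X.
Proof. by apply: pivotal_object_eq; case: X => -[]. Qed.

Definition pivotal_strict_pivotal : strict_pivotal N.
Proof.
refine (@StrictPivotal Mp N pivotal_duals _ _ _ _ _ pivotal_dualK _).
- split; [exact: pivotal_dual_unit | by move=> X Y; exact: pivotal_dual_tens|].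
  (* In the opposite category arrows are reversed: over [Mp], f runs from X' to X and the tensor
     product is g ⊗ f, whence the dualities of Y' and X'. *)
  move=> X X' Y Y' f g; apply: pivotal_heq; try exact: pivotal_dual_tens.
  rewrite pmor_tensm !pmor_dual; congr arrow.
  exact: (dual_mor_tens _ _ _ _ (p_duality Y') (p_duality X')).
- apply: pivotal_heq => //=; [exact: pivotal_tens1o | by rewrite arrowE].
- apply: pivotal_heq => //=; [exact: pivotal_tens1o | by rewrite arrowE].
- move=> X Y; apply: pivotal_heq => //.
  by rewrite /ev_tens !(pmor_eqhoml, pmor_eqhomr, pmorM) /= !arrowE.
- move=> X Y; apply: pivotal_heq => //.
  by rewrite /coev_tens !(pmor_eqhoml, pmor_eqhomr, pmorM) /= !arrowE.
- move=> X Y f; apply: pivotal_heq; try exact: pivotal_dualK.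
  (* The equation f^** = f is the defining condition of a pivotal morphism. *)
  by rewrite !pmor_dual [in RHS](pmorP f).
Defined.

(** * The braiding on pivotal objects *)

Lemma bidual_mor1 (X : pivotal_object M) :
  @bidual_mor C M X X (idm (po X)) = idm (po X).
Proof. by rewrite -pivotal_id_subproof. Qed.

Lemma bidual_morM (X Y Z : pivotal_object M) (g : hom (po Y) (po Z))
    (f : hom (po X) (po Y)) :
  @bidual_mor C M X Z (g \c f) = @bidual_mor C M Y Z g \c @bidual_mor C M X Y f.
Proof.
rewrite /bidual_mor (dual_morM _ _ _ (p_duality X) (p_duality Y)).
by rewrite (dual_morM _ _ _ (p_dualitys Z) (p_dualitys Y)).
Qed.

(** The double dual is functorial, so g^** is a left inverse of f^** = f and must equal the right
    inverse g. This makes the inverse braiding pivotal. *)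
Lemma bidual_mor_inv (X Y : pivotal_object M) (f : pivotal_hom X Y)
    (g : hom (po Y) (po X)) :
  g \c pmor f = idm _ -> pmor f \c g = idm _ -> g = @bidual_mor C M Y X g.
Proof.
move=> gf fg; have := @bidual_morM X Y X g (pmor f).
rewrite gf bidual_mor1 -(pmorP f) => E.
by rewrite -[RHS]compm1 -fg compA -E comp1m.
Qed.

Variable psi : braiding M.

Lemma pivotal_braid_subproof (X Y : pivotal_object M) :
  psi (po X) (po Y) =
  @bidual_mor C M (pivotal_tens X Y) (pivotal_tens Y X) (psi (po X) (po Y)).
Proof.
rewrite /bidual_mor /= (dual_mor_braid _ (p_duality X) (p_duality Y)).
by rewrite (dual_mor_braid _ (p_dualitys X) (p_dualitys Y)).
Qed.

Definition pivotal_braid (X Y : Mp) : hom (tens N X Y) (tens N Y X) :=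
  @PivotalHom C M (pivotal_tens X Y) (pivotal_tens Y X) _
    (pivotal_braid_subproof X Y).

Definition pivotal_braiding : braiding N.
Proof.
refine (@Braiding Mp N pivotal_braid _ _ _ _).
- move=> X Y; have [g [gf fg]] := braid_iso psi (po X) (po Y).
  exists (@PivotalHom C M (pivotal_tens Y X) (pivotal_tens X Y) g
    (bidual_mor_inv (f := pivotal_braid X Y) gf fg)).
  by split; apply: pivotal_hom_eq.
- by move=> X X' Y Y' f g; apply/pivotal_hom_eq/braid_nat.
- move=> X Y Z; apply: pivotal_heq;
    [exact/esym/pivotal_tensA | exact: pivotal_tensA|].
  by rewrite !(pmor_eqhoml, pmor_eqhomr, pmorM) /= braid_arrow_tensl !arrowE.
- move=> X Y Z; apply: pivotal_heq;
    [exact: pivotal_tensA | exact/esym/pivotal_tensA|].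
  by rewrite !(pmor_eqhoml, pmor_eqhomr, pmorM) /= braid_arrow_tensr !arrowE.
Defined.

End PivotalObjects.

Theorem proposition3p3 (C : category) (M : strict_monoidal C)
    (psi : braiding M) :
  exists N : strict_braided_pivotal (pivotal_category M),
    standard_pivotal_structure (sbp_pivotal N) /\
    strict_braided_monoidal_functor (sbp_braiding N) psi (forgetful M).
Proof.
exists (@StrictBraidedPivotal _ (pivotal_monoidal M) (pivotal_strict_pivotal M)
  (pivotal_braiding psi)).
(* The structure was built from the prescribed data, so every condition holds by computation. *)
by do ![split].
Qed.
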